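(* A uniformly topologically expansive operator on a locally convex space is neither Li-Yorke chaotic nor topologically transitive.
   Context: Locally convex spaces are over $\mathbb{K}$, where $\mathbb{K}$ is $\mathbb{R}$ or $\mathbb{C}$, and all topological vector spaces are assumed to be Hausdorff. Let $X$ be a locally convex space whose topology is induced by a family $(\|\cdot\|_\alpha)_{\alpha\in I}$ of seminorms that is directed (for all $\alpha,\beta\in I$ there is $\gamma\in I$ with $\|\cdot\|_\alpha\le\|\cdot\|_\gamma$ and $\|\cdot\|_\beta\le\|\cdot\|_\gamma$). A continuous linear operator $T$ on $X$ with continuous inverse is uniformly topologically expansive if for every $\alpha\in I$ there exists $\beta\in I$ such that one can write $\{x\in X:\|x\|_\alpha=1\}=A_\alpha\cup B_\alpha$, where $\|T^nx\|_\beta\to\infty$ uniformly on $A_\alpha$ as $n\to\infty$ and $\|T^{-n}x\|_\beta\to\infty$ uniformly on $B_\alpha$ as $n\to\infty$ (this does not depend on the choice of the directed family inducing the topology). A continuous linear operator $T$ on $X$ is Li-Yorke chaotic if there is an uncountable set $S\subset X$ such that each pair $(x,y)$ of distinct points of $S$ satisfies: (LY1) for every neighborhood $V$ of $0$ in $X$ there exists $n\in\mathbb{N}$ such that $T^nx-T^ny\in V$; (LY2) there exists a neighborhood $U$ of $0$ in $X$ such that $T^nx-T^ny\notin U$ for infinitely many values of $n$. Here $\mathbb{N}$ is the set of positive integers. A continuous linear operator $T$ on $X$ is topologically transitive if for every pair $A,B$ of nonempty open sets in $X$ there is an integer $n\ge0$ with $T^n(A)\cap B\neq\emptyset$.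
   Formalization: The claim that the operator is not topologically transitive is stated for a nonzero locally convex space, because the identity on {0} is uniformly topologically expansive and topologically transitive. *)

(* Defs.v *)
From HB Require Import structures.
From mathcomp Require Import all_boot all_order all_algebra.
From mathcomp Require Import all_classical all_reals all_analysis.
From mathcomp Require Export complex.
Set Implicit Arguments.
Unset Strict Implicit.
Unset Printing Implicit Defensive.
Import Order.TTheory GRing.Theory Num.Theory.
Import numFieldNormedType.Exports.
Local Open Scope classical_set_scope.
Local Open Scope ring_scope.

(* As for the norm of a [normedModType K], a seminorm takes its values in the
   scalar field K itself; in R[i], [0 <= z] means that z is a nonnegative real,
   so [seminorm_ge0] makes these values real also over the complex numbers. *)
Record is_seminorm (K : numFieldType) (X : lmodType K) (p : X -> K) : Prop :=
  IsSeminorm {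
    seminorm_ge0 : forall x, 0 <= p x;
    seminorm_triangle : forall x y, p (x + y) <= p x + p y;
    seminorm_homogeneous : forall a x, p (a *: x) = `|a| * p x }.

Definition directed_seminorms (K : numFieldType) (X : lmodType K) (I : Type)
    (p : I -> X -> K) : Prop :=
  forall a b, exists c,
    (forall x, p a x <= p c x) /\ (forall x, p b x <= p c x).

(* The neighbourhoods of x are the supersets of the finite intersections of
   balls centred at x; the directedness of p is not built in. *)
Definition induces_topology (K : numFieldType) (X : tvsType K) (I : Type)
    (p : I -> X -> K) : Prop :=
  forall (x : X) (U : set X),
    nbhs x U <->
    exists (m : nat) (a : 'I_m -> I) (e : K), 0 < e /\
      [set y | forall k : 'I_m, p (a k) (y - x) < e] `<=` U.

(* The bounds M are restricted to positive elements because the order of R[i]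
   is partial: no real number is above a non-real M. *)
Definition unif_to_infty (K : numFieldType) (X : Type) (f : nat -> X -> K)
    (A : set X) : Prop :=
  forall M : K, 0 < M -> \forall n \near \oo, forall x, A x -> M <= f n x.

(* [Tinv] is meant to be the inverse of [T]. *)
Definition unif_top_expansive (K : numFieldType) (X : lmodType K) (I : Type)
    (p : I -> X -> K) (T Tinv : X -> X) : Prop :=
  forall a : I, exists (b : I) (A B : set X),
    [/\ [set x | p a x = 1] = A `|` B,
        unif_to_infty (fun n x => p b (iter n T x)) A &
        unif_to_infty (fun n x => p b (iter n Tinv x)) B].

Definition li_yorke_pair (K : numFieldType) (X : tvsType K) (T : X -> X)
    (x y : X) : Prop :=
  (forall V : set X, nbhs (0 : X) V ->
     exists n : nat, (0 < n)%N /\ V (iter n T x - iter n T y)) /\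
  (exists U : set X, nbhs (0 : X) U /\
     infinite_set [set n : nat | (0 < n)%N /\ ~ U (iter n T x - iter n T y)]).

Definition li_yorke_chaotic (K : numFieldType) (X : tvsType K) (T : X -> X)
    : Prop :=
  exists S : set X, ~ countable S /\
    forall x y, S x -> S y -> x <> y -> li_yorke_pair T x y.

Definition topologically_transitive (X : topologicalType) (T : X -> X)
    : Prop :=
  forall A B : set X, open A -> open B -> A !=set0 -> B !=set0 ->
    exists n : nat, (iter n T @` A) `&` B !=set0.

(* Main.v *)
(* Rescaling the unit sphere of p_a gives a dichotomy: once n is large, every x
   with p_a(x) > 0 satisfies p_b(T^n x) >= M p_a(x) for all such n, or
   p_b(T^-n x) >= M p_a(x) for all such n.
   Li-Yorke pairs: let z be the difference of the two points. By (LY2) some p_a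
   has p_a(T^n z) >= e for infinitely many n. For large n the backward
   alternative at T^n z would give p_b(z) >= M e, which is false for large M; so
   the forward one holds and p_b(T^k z) >= 1 eventually, against (LY1), because
   the finitely many remaining iterates are nonzero and can be avoided too.
   Transitivity: it would produce m, n large and w with w, T^m w and T^(m+n) w
   in the open set {p_a > 1, p_b < C}, so that T^m w grows in neither
   direction. *)

Require Import Defs.
From HB Require Import structures.
From mathcomp Require Import all_boot all_order all_algebra.
From mathcomp Require Import all_classical all_reals all_analysis.
Set Implicit Arguments.
Unset Strict Implicit.
Unset Printing Implicit Defensive.
Import Order.TTheory GRing.Theory Num.Theory.
Import numFieldNormedType.Exports.
Local Open Scope classical_set_scope.
Local Open Scope complex_scope.
Local Open Scope ring_scope.

Lemma iterZ (K : numFieldType) (X : lmodType K) (f : X -> X)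
    (fZ : forall c x, f (c *: x) = c *: f x) n c x :
  iter n f (c *: x) = c *: iter n f x.
Proof. by elim: n => //= n ->; rewrite fZ. Qed.

Lemma iter_can (X : Type) (f g : X -> X) n :
  cancel f g -> cancel (iter n f) (iter n g).
Proof. by move=> fK; elim: n => // n IHn x; rewrite iterSr /= fK IHn. Qed.

Lemma continuous_iter (X : topologicalType) (f : X -> X) n :
  continuous f -> continuous (iter n f).
Proof.
move=> fC; elim: n => [|n IHn] x; first exact: cvg_id.
by apply: (@continuous_comp _ _ _ (iter n f) f); [exact: IHn|exact: fC].
Qed.

Lemma infinite_set_ge (S : set nat) N :
  infinite_set S -> exists2 n, (N <= n)%N & S n.
Proof.
move=> Sinf; apply: contrapT => noS; apply: Sinf.
apply: (@sub_finite_set _ _ `I_N) => // n Sn /=.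
by rewrite ltnNge; apply/negP => Nn; apply: noS; exists n.
Qed.

Section Seminorms.
Variables (K : numFieldType) (X : lmodType K) (p : X -> K).
Hypothesis hp : is_seminorm p.

Lemma seminormB x y : p (x - y) = p (y - x).
Proof.
by rewrite -[x - y]opprB -(scaleN1r (y - x)) (seminorm_homogeneous hp) normrN1 mul1r.
Qed.

Lemma seminorm_sub x y : p x - p (y - x) <= p y.
Proof.
rewrite lerBlDr; have := seminorm_triangle hp y (x - y).
by rewrite subrKC seminormB.
Qed.

(** The order of [K] may be partial; the comparison can be reversed because both sides are
    nonnegative, hence real. *)
Lemma seminorm_leNlt (M : K) x : 0 <= M -> (M <= p x) = ~~ (p x < M).
Proof.
by move=> M0; rewrite real_leNgt ?ger0_real// (seminorm_ge0 hp).
Qed.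

End Seminorms.

Section SeminormTopology.
Variables (K : numFieldType) (X : tvsType K) (I : Type) (p : I -> X -> K).
Hypothesis hp : forall a, is_seminorm (p a).
Hypothesis htop : induces_topology p.

Lemma nbhs_seminorm_ball a x (e : K) :
  0 < e -> nbhs x [set y | p a (y - x) < e].
Proof.
move=> e0; apply/htop; exists 1%N, (fun=> a), e; split=> // y /=.
by apply; exact: ord0.
Qed.

Lemma open_seminorm_lt a (c : K) : open [set x | p a x < c].
Proof.
rewrite openE => x /= xc.
have e0 : 0 < c - p a x by rewrite subr_gt0.
apply: filterS (nbhs_seminorm_ball a x e0) => y /= yx.
apply: le_lt_trans (_ : p a x + p a (y - x) < c); last by rewrite -ltrBrDl.
by have := seminorm_triangle (hp a) x (y - x); rewrite subrKC.
Qed.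

Lemma open_seminorm_gt a (c : K) : open [set x | c < p a x].
Proof.
rewrite openE => x /= xc.
have e0 : 0 < p a x - c by rewrite subr_gt0.
apply: filterS (nbhs_seminorm_ball a x e0) => y /= yx.
apply: lt_le_trans (seminorm_sub (hp a) x y).
by rewrite ltrBrDr -ltrBrDl.
Qed.

Lemma hausdorff_nbhs_neq (x y : X) :
  hausdorff_space X -> x <> y -> nbhs y [set z | z <> x].
Proof.
move=> hX xy; have : closed [set x].
  by apply: accessible_closed_set1; exact: hausdorff_accessible.
move/closed_openC => oC; apply: open_nbhs_nbhs; split => //= yx; exact: xy.
Qed.

(** Some neighbourhood of 0 avoids [x]; it contains a finite intersection of balls of radius [e], so
    [x] lies outside one of these balls. *)
Lemma hausdorff_seminorm_gt0 (x : X) :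
  hausdorff_space X -> x <> 0 -> exists a, 0 < p a x.
Proof.
move=> hX x0; have /htop[m [a [e [e0 sub]]]] := hausdorff_nbhs_neq hX x0.
apply: contrapT => nop; apply: (sub x) => //= k; rewrite subr0.
apply: contrapT => /negP; rewrite -(seminorm_leNlt (hp _) _ (ltW e0)) => ex.
by apply: nop; exists (a k); exact: lt_le_trans ex.
Qed.

(** Pigeonhole: a point outside [U] leaves one of finitely many balls, so one seminorm accounts for
    infinitely many indices. *)
Lemma seminorm_ge_infinitely_often (u : nat -> X) (S : set nat) (U : set X) :
  nbhs 0 U -> infinite_set [set n | S n /\ ~ U (u n)] ->
  exists a (e : K), 0 < e /\ infinite_set [set n | S n /\ e <= p a (u n)].
Proof.
move=> /htop[m [a [e [e0 sub]]]] Uinf; apply: contrapT => nop; apply: Uinf.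
pose F (k : 'I_m) := [set n | S n /\ e <= p (a k) (u n)].
apply: (@sub_finite_set _ _ (\bigcup_(k in [set: 'I_m]) F k)); last first.
  apply: bigcup_finite => // k _; apply: contrapT => Finf.
  by apply: nop; exists (a k), e.
move=> n [Sn nU]; apply: contrapT => nF; apply: nU; apply: sub => k /=.
rewrite subr0; apply: contrapT => /negP; rewrite -(seminorm_leNlt (hp _) _ (ltW e0)) => ex.
by apply: nF; exists k.
Qed.

End SeminormTopology.

(** Uniform divergence makes [N] independent of [x]. The alternative is chosen once for all [n],
    according to whether the normalised vector lies in [A] or in [B]. *)
Lemma expansive_dichotomy (K : numFieldType) (X : lmodType K) (I : Type)
    (p : I -> X -> K) (T Tinv : X -> X) :
  (forall a, is_seminorm (p a)) ->
  (forall c x, T (c *: x) = c *: T x) ->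
  (forall c x, Tinv (c *: x) = c *: Tinv x) ->
  unif_top_expansive p T Tinv ->
  forall a, exists b, forall M : K, 0 < M -> exists N, forall x, 0 < p a x ->
    (forall n, (N <= n)%N -> M * p a x <= p b (iter n T x)) \/
    (forall n, (N <= n)%N -> M * p a x <= p b (iter n Tinv x)).
Proof.
move=> hp TZ TinvZ hexp a; have [b [A [B [AB TA TB]]]] := hexp a.
exists b => M M0.
have [NA _ hA] := TA _ M0; have [NB _ hB] := TB _ M0.
exists (maxn NA NB) => x x0; pose u := (p a x)^-1 *: x.
have pV (c : I) y : p c ((p a x)^-1 *: y) = (p a x)^-1 * p c y.
  by rewrite (seminorm_homogeneous (hp c)) ger0_norm// invr_ge0 ltW.
have : [set y | p a y = 1] u by rewrite /u /= pV mulVf// gt_eqF.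
rewrite AB => -[uA|uB]; [left|right] => n; rewrite geq_max => /andP[nA nB].
- have := hA n nA u uA.
  by rewrite /u iterZ// pV [_^-1 * _]mulrC ler_pdivlMr.
- have := hB n nB u uB.
  by rewrite /u iterZ// pV [_^-1 * _]mulrC ler_pdivlMr.
Qed.

Lemma transitive_return_times (X : topologicalType) (T Tinv : X -> X) :
  continuous Tinv -> cancel T Tinv -> cancel Tinv T ->
  topologically_transitive T -> forall (U : set X) N, open U -> U !=set0 ->
  exists2 n, (N <= n)%N & U `&` iter n T @^-1` U !=set0.
Proof.
(* Transitivity is applied to T^N(U), which is open because T^-N is continuous,
   and to U: a visit of T^N(U) to U is a return of U after at least N steps. *)
move=> TinvC TK TinvK Ttr U N Uo [u Uu].
have Vo : open (iter N Tinv @^-1` U).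
  by apply: open_comp => // x _; exact: continuous_iter.
have V0 : iter N Tinv @^-1` U !=set0.
  by exists (iter N T u); rewrite /preimage/= iter_can.
have [n [_ [[y Vy <-] Uy]]] := Ttr _ _ Vo Uo V0 (ex_intro _ u Uu).
exists (n + N)%N; first exact: leq_addl.
exists (iter N Tinv y); split => //.
by rewrite /preimage/= iterD (iter_can N TinvK).
Qed.

Section Expansive.
Variables (K : numFieldType) (X : tvsType K) (I : Type) (p : I -> X -> K).
Hypothesis hp : forall a, is_seminorm (p a).
Hypothesis htop : induces_topology p.
Hypothesis hX : hausdorff_space X.
Variables (T : {linear X -> X}) (Tinv : X -> X).
Hypotheses (hTK : cancel T Tinv) (hTinvK : cancel Tinv T).
Hypothesis hexp : unif_top_expansive p T Tinv.

Let dichotomy a : exists b, forall M : K, 0 < M -> exists N, forall x,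
  0 < p a x ->
    (forall n, (N <= n)%N -> M * p a x <= p b (iter n T x)) \/
    (forall n, (N <= n)%N -> M * p a x <= p b (iter n Tinv x)).
Proof.
apply: expansive_dichotomy => // c x; first exact: linearZ.
by apply: (can_inj hTK); rewrite hTinvK linearZ hTinvK.
Qed.

Lemma expansive_not_li_yorke_pair x y : x <> y -> ~ li_yorke_pair T x y.
Proof.
move=> xy [LY1 [U [U0 Uinf]]]; pose z := x - y.
have iterB n : iter n T x - iter n T y = iter n T z.
  by elim: n => //= n <-; rewrite linearB.
have iterz0 n : iter n T z <> 0.
  have -> : 0 = iter n T 0 by elim: n => //= n <-; rewrite linear0.
  by move/(can_inj (iter_can n hTK))/eqP; rewrite subr_eq0 => /eqP.
have [a [e [e0 einf]]] := seminorm_ge_infinitely_often hp htop U0 Uinf.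
(* [M * e] is [p b z + 1]: this exceeds [p b z], which refutes the backward alternative, and is at
   least 1, which bounds the forward orbit from below. *)
have [b hb] := dichotomy a; pose M := (p b z + 1) / e.
have M0 : 0 < M by rewrite divr_gt0// ltr_wpDl// (seminorm_ge0 (hp b)).
have [N hN] := hb M M0.
have [n Nn [_]] := infinite_set_ge N einf; rewrite iterB => en.
have Mn : p b z + 1 <= M * p a (iter n T z).
  by rewrite -[leLHS](divfK (lt0r_neq0 e0)) ler_pM2l.
have [fwd|bwd] := hN _ (lt_le_trans e0 en); last first.
  have := le_trans Mn (bwd n Nn); rewrite (iter_can n hTK).
  by rewrite gerDl ler10.
have big k : (N + n <= k)%N -> 1 <= p b (iter k T z).
  move=> Nk; have nk : (n <= k)%N by apply: leq_trans Nk; rewrite leq_addl.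
  rewrite -(subnK nk) iterD; apply: le_trans (fwd _ _);
    last by rewrite leq_subRL// addnC.
  by apply: le_trans Mn; rewrite lerDr (seminorm_ge0 (hp b)).
(* Avoiding the first [N + n] iterates forces the time given by (LY1) into the range of [big]. *)
have V0 : nbhs (0 : X) [set w | p b w < 1 /\
    forall i : 'I_(N + n), w <> iter i T z].
  apply: filterI; last by apply: filter_forall => i; exact: hausdorff_nbhs_neq.
  apply: filterS (nbhs_seminorm_ball htop b 0 ltr01) => w /=.
  by rewrite subr0.
have [k [_]] := LY1 _ V0; rewrite iterB => -[small neq].
have [kN|Nk] := ltnP k (N + n); first exact: (neq (Ordinal kN)).
by have := lt_le_trans small (big k Nk); rewrite ltxx.
Qed.

Lemma expansive_not_transitive (x : X) :
  continuous T -> continuous Tinv -> x <> 0 -> ~ topologically_transitive T.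
Proof.
move=> hT hTinv x0 Ttr.
have [a pax] := hausdorff_seminorm_gt0 hp htop hX x0.
(* The scaling gives [p a u = 2], and [C] exceeds [p b u], so [u] witnesses that [U] below is
   nonempty. Taking [C] also as growth factor makes either alternative at a point of [U] contradict
   [p b w < C]. *)
have [b hb] := dichotomy a; pose u := (2 / p a x) *: x.
pose C := p b u + 1.
have C0 : 0 < C by rewrite ltr_wpDl// (seminorm_ge0 (hp b)).
have [N hN] := hb C C0.
pose U := [set w | 1 < p a w] `&` [set w | p b w < C].
have Uo : open U.
  by apply: openI; [exact: open_seminorm_gt|exact: open_seminorm_lt].
have U0 : U !=set0.
  exists u; split => /=; last by rewrite ltrDl.
  rewrite (seminorm_homogeneous (hp a)) ger0_norm ?divr_ge0 ?ltW//.
  by rewrite divfK ?gt_eqF// ltr1n.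
have [m Nm W0] := transitive_return_times hTinv hTK hTinvK Ttr N Uo U0.
(* The points of [U] that return at time [m] form a nonempty open set; a return of this set at time
   [n] puts [w], [T^m w] and [T^(m+n) w] in [U]. *)
have Wo : open (U `&` iter m T @^-1` U).
  by apply: openI => //; apply: open_comp => // w _; exact: continuous_iter.
have [n Nn [w [[Uw Umw] [_ Umnw]]]] :=
  transitive_return_times hTinv hTK hTinvK Ttr N Wo W0.
(* T^m w lies in U together with its images under T^n and T^-m, so it can
   grow neither forwards nor backwards. *)
have CM : C <= C * p a (iter m T w) by rewrite ler_peMr// ltW// (proj1 Umw).
have small v : U v -> ~ (C * p a (iter m T w) <= p b v).
  move=> [_ /= vC] /(le_trans CM) Cv.
  by have := lt_le_trans vC Cv; rewrite ltxx.
have [fwd|bwd] := hN _ (lt_trans ltr01 (proj1 Umw)).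
- apply: (small _ Umnw).
  by have := fwd n Nn; rewrite -!iterD addnC.
- apply: (small _ Uw).
  by have := bwd m Nm; rewrite (iter_can m hTK).
Qed.

End Expansive.

Theorem theorem38 (R : realType) (K : numFieldType)
    (hK : K = (R : numFieldType) \/ K = (R[i] : numFieldType))
    (X : tvsType K) (hX : hausdorff_space X)
    (I : Type) (p : I -> X -> K)
    (hp : forall a : I, is_seminorm (p a))
    (hdir : directed_seminorms p)
    (htop : induces_topology p)
    (T : {linear X -> X}) (Tinv : X -> X)
    (hT : continuous T) (hTinv : continuous Tinv)
    (hTK : cancel T Tinv) (hTinvK : cancel Tinv T)
    (hexp : unif_top_expansive p T Tinv) :
  ~ li_yorke_chaotic T /\
  ((exists x : X, x <> 0) -> ~ topologically_transitive T).
Proof.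
split; last first.
  move=> [x x0].
  exact: (expansive_not_transitive hp htop hX hTK hTinvK hexp hT hTinv x0).
(* Without Li-Yorke pairs of distinct points, [S] has at most one element. *)
move=> [S [Sunc SLY]]; apply: Sunc; apply: finite_set_countable.
have [->|/set0P[x Sx]] := eqVneq S set0; first exact: finite_set0.
apply: sub_finite_set (finite_set1 x) => y Sy; apply: contrapT => yx.
have := SLY _ _ Sy Sx yx.
exact: (expansive_not_li_yorke_pair hp htop hX hTK hTinvK hexp yx).
Qed.
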